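(* The following hold for varieties of completely regular semigroups. (i) All the subvarieties of $\mathbf{BG}$ are locally $\mathcal{H}$-finite. (ii) Every variety $\mathbf{V}$ with $\mathbf{LRO}\subseteq\mathbf{V}\subseteq\mathbf{ROL^*}$ is locally $\mathcal{L}$-finite but not locally $\mathcal{R}$-finite. (iii) Every variety $\mathbf{V}$ with $\mathbf{RRO}\subseteq\mathbf{V}\subseteq\mathbf{ROR^*}$ is locally $\mathcal{R}$-finite but not locally $\mathcal{L}$-finite. (iv) Every variety $\mathbf{V}$ with $\mathbf{RO}\subseteq\mathbf{V}\subseteq\mathbf{CR}$ is locally $\mathcal{D}$-finite but neither locally $\mathcal{L}$-finite nor locally $\mathcal{R}$-finite.
   Context: Green's relations on a semigroup $S$: $a\,\mathcal{L}\,b \iff S^1a=S^1b$; $a\,\mathcal{R}\,b\iff aS^1=bS^1$; $\mathcal{H}=\mathcal{L}\cap\mathcal{R}$; $\mathcal{D}=\mathcal{L}\vee\mathcal{R}$. For $\mathcal{K}\in\{\mathcal{H},\mathcal{L},\mathcal{R},\mathcal{D}\}$, a semigroup is $\mathcal{K}$-finite if it has only finitely many distinct $\mathcal{K}$-classes. A variety $\mathbf{V}$ is locally $\mathcal{K}$-finite if each finitely generated member of $\mathbf{V}$ is $\mathcal{K}$-finite. $\mathbf{CR}$ is the variety of all completely regular semigroups, viewed as algebras of type $(2,1)$ satisfying $x(yz)=(xy)z$, $(x')'=x$, $xx'x=x$, $xx'=x'x$; so $a'$ is the unique inverse of $a$ that commutes with $a$. Varieties of completely regular semigroups are subvarieties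 of $\mathbf{CR}$ and ''finitely generated'' refers to this type. A band is a semigroup of idempotents. A band $B$ is regular if $axya=axaya$ for all $a,x,y\in B$; left regular if $ax=axa$ for all $a,x\in B$; right regular if $xa=axa$ for all $a,x\in B$. An orthogroup is a completely regular semigroup $S$ whose set $E(S)$ of idempotents is a subsemigroup; it is a regular (left regular, right regular) orthogroup if $E(S)$ is a regular (left regular, right regular) band. A cryptogroup is a completely regular semigroup in which $\mathcal{H}$ is a congruence. The following classes are subvarieties of $\mathbf{CR}$: $\mathbf{BG}$ (cryptogroups); $\mathbf{RO}$ (regular orthogroups); $\mathbf{LRO}$ (left regular orthogroups); $\mathbf{RRO}$ (right regular orthogroups); $\mathbf{ROL^*}$ (regular orthogroups in which $\mathcal{L}$ is a congruence); $\mathbf{ROR^*}$ (regular orthogroups in which $\mathcal{R}$ is a congruence). *)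

(* Defs.v *)
From HB Require Import structures.
From mathcomp Require Import all_boot.
From mathcomp Require Import boolp classical_sets functions cardinality.
From Stdlib Require Import Relation_Definitions Relation_Operators.

Set Implicit Arguments.
Unset Strict Implicit.
Unset Printing Implicit Defensive.

Local Open Scope classical_set_scope.
Local Open Scope group_scope.

(* [semigroupType] carriers are choiceTypes; with the classical axioms of
   [boolp] every type can be equipped with that structure, so this does not
   restrict the class of semigroups. The empty semigroup is not excluded; it
   satisfies every identity and is trivially K-finite for each K below. *)
HB.mixin Record isCompletelyRegular S of Semigroup S := {
  crinv : S -> S;
  crinvK : involutive crinv;
  mulg_crinv_mulg : forall x : S, x * crinv x * x = x;
  crinv_comm : forall x : S, x * crinv x = crinv x * x
}.

#[short(type="crSemigroupType")]
HB.structure Definition CRSemigroup :=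
  {S of isCompletelyRegular S & Semigroup S}.

Section Green.
Variable S : semigroupType.
Implicit Types a b : S.

(* S^1 a = {a} \cup S a and a S^1 = {a} \cup a S, whether or not S has an
   identity element. *)
Definition left_ideal a : set S := [set a] `|` [set s * a | s in setT].
Definition right_ideal a : set S := [set a] `|` [set a * s | s in setT].

Definition greenL a b : Prop := left_ideal a = left_ideal b.
Definition greenR a b : Prop := right_ideal a = right_ideal b.
Definition greenH a b : Prop := greenL a b /\ greenR a b.

(* The join in the lattice of equivalence relations. *)
Definition greenD : S -> S -> Prop :=
  clos_refl_sym_trans S (fun a b => greenL a b \/ greenR a b).

Definition finitely_many_classes (K : S -> S -> Prop) : Prop :=
  finite_set [set [set b | K a b] | a in setT].

Definition congruence (K : S -> S -> Prop) : Prop :=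
  equivalence S K /\
  (forall a b c d, K a b -> K c d -> K (a * c) (b * d)).

Definition subsemigroup (B : set S) : Prop :=
  forall x y, B x -> B y -> B (x * y).

Definition idempotents : set S := [set e | e * e = e].

Definition band (B : set S) : Prop := subsemigroup B /\ B `<=` idempotents.

Definition regular_band (B : set S) : Prop :=
  band B /\ forall a x y, B a -> B x -> B y ->
    a * x * y * a = a * x * a * y * a.

Definition left_regular_band (B : set S) : Prop :=
  band B /\ forall a x, B a -> B x -> a * x = a * x * a.

Definition right_regular_band (B : set S) : Prop :=
  band B /\ forall a x, B a -> B x -> x * a = a * x * a.

End Green.

Definition closed_subalgebra (S : crSemigroupType) (A : set S) : Prop :=
  subsemigroup A /\ (forall x, A x -> A (crinv x)).

Definition finitely_generated (S : crSemigroupType) : Prop :=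
  exists A : set S, finite_set A /\ smallest (@closed_subalgebra S) A = setT.

(* Classes are plain predicates rather than [set crSemigroupType], which
   would force needless universe constraints on the carriers. *)
Definition cr_class := crSemigroupType -> Prop.

Definition subclass (V W : cr_class) : Prop := forall S, V S -> W S.

Inductive cr_term : Type :=
| Var of nat
| Mul of cr_term & cr_term
| Inv of cr_term.

Fixpoint eval (S : crSemigroupType) (v : nat -> S) (t : cr_term) : S :=
  match t with
  | Var n => v n
  | Mul t1 t2 => eval v t1 * eval v t2
  | Inv t1 => crinv (eval v t1)
  end.

Definition satisfies (S : crSemigroupType) (s t : cr_term) : Prop :=
  forall v : nat -> S, eval v s = eval v t.

(* Equational classes (by Birkhoff, the HSP-closed classes); the CR identities
   are built into crSemigroupType. *)
Definition variety (V : cr_class) : Prop :=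
  exists Sigma : cr_term -> cr_term -> Prop,
    forall S : crSemigroupType,
      V S <-> (forall s t, Sigma s t -> satisfies S s t).

Definition locally_finite (K : forall S : semigroupType, S -> S -> Prop)
    (V : cr_class) : Prop :=
  forall S : crSemigroupType,
    V S -> finitely_generated S -> finitely_many_classes (K S).

Definition orthogroup (S : crSemigroupType) : Prop :=
  subsemigroup (@idempotents S).

Definition CR : cr_class := fun=> True.

Definition BG : cr_class := fun S => congruence (@greenH S).

Definition RO : cr_class := fun S =>
  orthogroup S /\ regular_band (@idempotents S).

Definition LRO : cr_class := fun S =>
  orthogroup S /\ left_regular_band (@idempotents S).

Definition RRO : cr_class := fun S =>
  orthogroup S /\ right_regular_band (@idempotents S).

Definition ROLstar : cr_class := fun S => RO S /\ congruence (@greenL S).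

Definition RORstar : cr_class := fun S => RO S /\ congruence (@greenR S).

(* Main.v *)
Require Import Defs.
From Stdlib Require Import Relation_Operators.
From HB Require Import structures.
From mathcomp Require Import all_boot ssralg ssrint.
From mathcomp Require Import boolp classical_sets cardinality.

Set Implicit Arguments.
Unset Strict Implicit.
Unset Printing Implicit Defensive.

Local Open Scope classical_set_scope.
Local Open Scope group_scope.

(** The positive parts all rest on one observation.  In a completely regular
    semigroup S every element is H-related, hence also L-, R- and D-related, to
    its square.  So if K is one of these relations and K happens to be a
    congruence on S, then S / K is a band; it is generated by the image of any
    generating set of S, because a and its inverse have the same image.
    Finitely generated bands are finite ([finite_band], the Green-Rees
    theorem), and therefore S has finitely many K-classes
    ([finitely_many_classes_congruence]).  For H, L and R the congruence
    property is what membership in BG, ROL^* and ROR^* provides.  For D it is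
    automatic ([greenD_congruence]): a * b and b * a are always D-related, which
    lets the right compatibility of L and the left compatibility of R pass to
    both sides of D.

    Finiteness of a finitely generated band is proved by induction on the number
    of distinct letters of a word w.  In a band, a word absorbs every word
    written with its own letters: w v w = w.  Consequently w is the product of
    its shortest prefix and its shortest suffix using all the letters of w
    ([value_prefix_suffix]).  With its extreme letter removed, each of these has
    fewer distinct letters than w.

    For the negative parts a single semigroup is enough: the maps of Z into
    itself that are translations or constants.  It is generated by the
    translation by 1 and the constant 0, the only idempotents are the identity
    and the constants, and these form a left regular band.  A constant map c
    satisfies c f = c for every f, so each constant is an R-class by itself.
    The opposite semigroup treats L and the right regular case, and RO contains
    both LRO and RRO. *)

(** * Finitely generated bands are finite *)
Section IdempotentMonoid.
Variable M : monoidType.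
Hypothesis idemM : forall x : M, x * x = x.
Implicit Types (a b x : M) (p q s t v w : seq M).

Local Notation value w := (\prod_(x <- w) x).

(** With e = u a v, the element e a (v e) is again e: the two copies of a v that
    meet in it collapse.  So e lies in the right ideal generated by the
    idempotent e a, and e a acts on e as a left identity. *)
Lemma absorb_factor (u a v : M) : (u * a * v) * a * (u * a * v) = u * a * v.
Proof.
set e := u * a * v.
have eE : e * a * (v * e) = e.
  transitivity (u * ((a * v) * (a * v)) * e); first by rewrite /e !mulgA.
  by rewrite idemM (mulgA u a v) -/e idemM.
by rewrite -{2}eE mulgA idemM eE.
Qed.

(** The elements x a and b x lie above and below each other through x, so they
    belong to one rectangular band, where (x a)(b x)(x a) = x a.  That identity
    is [absorb_factor] for the factorization x (b x) (x a) of x a. *)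
Lemma absorb_mul x a b :
  x * a * x = x -> x * b * x = x -> x * (a * b) * x = x.
Proof.
move=> xa xb.
have xaE : x * (b * x) * (x * a) = x * a.
  by rewrite !mulgA -(mulgA _ x x) idemM xb.
have xabxa : x * a * (b * x) * (x * a) = x * a.
  by have := absorb_factor x (b * x) (x * a); rewrite xaE.
by rewrite -[RHS]xa -[in RHS]xabxa -!mulgA (mulgA x a x) xa idemM.
Qed.

(** By [absorb_mul] it suffices to absorb single letters, and a letter a of w
    splits w as u a v. *)
Lemma absorb_subword w v : {subset v <= w} ->
  value w * value v * value w = value w.
Proof.
elim: v => [|a v IHv] sub_vw; first by rewrite big_nil mulg1 idemM.
rewrite big_cons; apply: absorb_mul; last first.
  by apply: IHv => x vx; apply: sub_vw; rewrite inE vx orbT.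
have /splitPr[p q] : a \in w by apply: sub_vw; rewrite mem_head.
by rewrite big_cat big_cons /= (mulgA (value p)) absorb_factor.
Qed.

(** As p and q contain all letters of w, p absorbs s and q absorbs t, whence
    w p = p and q w = q.  Then
    p q = w (p q) w, and w absorbs p q since every letter of p q occurs in w. *)
Lemma value_prefix_suffix w p s t q : w = p ++ s -> w = t ++ q ->
  {subset w <= p} -> {subset w <= q} -> value w = value p * value q.
Proof.
move=> wps wtq sub_wp sub_wq.
have wp : value w * value p = value p.
  rewrite wps big_cat /=; apply: absorb_subword => x sx.
  by apply: sub_wp; rewrite wps mem_cat sx orbT.
have qw : value q * value w = value q.
  rewrite wtq big_cat /= mulgA; apply: absorb_subword => x tx.
  by apply: sub_wq; rewrite wtq mem_cat tx.
rewrite -[RHS](_ : value w * value (p ++ q) * value w = _); last first.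
  by rewrite big_cat /= mulgA wp -mulgA qw.
rewrite absorb_subword // => x; rewrite mem_cat wps => /orP[px|qx].
  by rewrite mem_cat px.
by rewrite -wps wtq mem_cat qx orbT.
Qed.

Lemma shortest_full_prefix w : w != [::] ->
  exists p a s, [/\ w = p ++ a :: s, a \notin p & {subset w <= rcons p a}].
Proof.
elim/last_ind: w => // w b IHw _.
have [bw|bNw] := boolP (b \in w); last first.
  by exists w, b, [::]; rewrite cats1; split=> // x.
have [|p [a [s [wE aNp sub_w]]]] := IHw.
  by apply: contraTneq bw => ->; rewrite in_nil.
exists p, a, (rcons s b); split=> //; first by rewrite {1}wE rcons_cat.
by move=> x; rewrite mem_rcons inE => /predU1P[->|]; exact: sub_w.
Qed.

Lemma shortest_full_suffix w : w != [::] ->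
  exists t b q, [/\ w = t ++ b :: q, b \notin q & {subset w <= b :: q}].
Proof.
elim: w => // a w IHw _.
have [aw|aNw] := boolP (a \in w); last first.
  by exists [::], a, w; split=> // x.
have [|t [b [q [wE bNq sub_w]]]] := IHw.
  by apply: contraTneq aw => ->; rewrite in_nil.
exists (a :: t), b, q; split=> //; first by rewrite {1}wE.
by move=> x; rewrite inE => /predU1P[->|]; exact: sub_w.
Qed.

Lemma size_undup_lt w v a : a \in w -> a \notin v -> {subset v <= w} ->
  (size (undup v) < size (undup w))%N.
Proof.
move=> aw aNv sub_vw; apply: (@uniq_leq_size _ (a :: undup v)) => [|x] /=.
  by rewrite undup_uniq mem_undup aNv.
by rewrite inE !mem_undup => /predU1P[->|/sub_vw].
Qed.

(** [undup w] lists the distinct letters of [w]; their number is the quantity on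
    which the finiteness proof is by induction. *)
Definition words (A : set M) n : set (seq M) :=
  [set w | {in w, forall x, A x} /\ (size (undup w) <= n)%N].

(** A nonempty word with at most n + 1 distinct letters has the value
    (p a)(b q), where the words p and q miss the letters a and b respectively,
    so have at most n distinct letters.  There are finitely many choices for the
    values of p and q, and for a and b. *)
Lemma finite_word_values (A : set M) n : finite_set A ->
  finite_set [set value w | w in words A n].
Proof.
move=> finA; elim: n => [|n IHn].
  apply: (sub_finite_set _ (finite_set1 1)) => _ [w [_ w0] <-].
  have := mem_undup w; case: (undup w) w0 => // _ ww.
  case: w ww => [|a w] ww; first by rewrite big_nil.
  by have := ww a; rewrite mem_head.
set E := [set value w | w in words A n].
apply: (@sub_finite_set _ _
  ([set 1] `|` [set x * y | x in [set x * a | x in E & a in A]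
                          & y in [set a * x | a in A & x in E]])).
  move=> _ [w [Aw wn] <-]; have [->|w_n0] := eqVneq w [::].
    by left; rewrite big_nil.
  right.
  have [p [a [s [wE aNp sub_wp]]]] := shortest_full_prefix w_n0.
  have [t [b [q [wE' bNq sub_wq]]]] := shortest_full_suffix w_n0.
  have pw : {subset p <= w} by move=> x px; rewrite wE mem_cat px.
  have qw : {subset q <= w} by move=> x qx; rewrite wE' mem_cat inE qx !orbT.
  have aw : a \in w by rewrite wE mem_cat mem_head orbT.
  have bw : b \in w by rewrite wE' mem_cat mem_head orbT.
  have Ep : E (value p).
    exists p => //; split; first by move=> x /pw; exact: Aw.
    by rewrite -ltnS (leq_trans (size_undup_lt aw aNp pw)).
  have Eq : E (value q).
    exists q => //; split; first by move=> x /qw; exact: Aw.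
    by rewrite -ltnS (leq_trans (size_undup_lt bw bNq qw)).
  exists (value p * a); first
    by exists (value p) => //; exists a => //; exact: Aw.
  exists (b * value q); first by exists b; [exact: Aw|exists (value q)].
  rewrite (@value_prefix_suffix w (rcons p a) s t (b :: q)) ?cat_rcons //.
  by rewrite -cats1 big_cat big_seq1 big_cons.
by rewrite finite_setU; split=> //; apply: finite_image2; apply: finite_image2.
Qed.

(** No word over A has more distinct letters than A has elements. *)
Lemma finite_products (A : set M) : finite_set A ->
  finite_set [set value w | w in [set w | {in w, forall x, A x}]].
Proof.
move=> finA; have [s As] := (finite_seqP A).1 finA.
apply: (sub_finite_set _ (finite_word_values (size s) finA)).
move=> _ [w Aw <-]; exists w => //; split=> //.
apply: uniq_leq_size; first exact: undup_uniq.
by move=> x; rewrite mem_undup => /Aw; rewrite As.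
Qed.

End IdempotentMonoid.

(** The prefix that remains after removing the extreme letter may be empty, so
    the argument for bands takes place in the monoid B^1.  The unit is new even
    if B already has one, which keeps idempotency and makes the embedding of B
    injective. *)
Definition adjoin_one (B : Type) := option B.

Section AdjoinOne.
Variable B : semigroupType.

Definition adjoin_one_mul (x y : option B) : option B :=
  match x, y with
  | Some a, Some b => Some (a * b)
  | None, _ => y
  | _, None => x
  end.

Fact adjoin_one_mulA : associative adjoin_one_mul.
Proof. by move=> [x|] [y|] [z|] //=; rewrite mulgA. Qed.

Fact adjoin_one_1mul : left_id None adjoin_one_mul.
Proof. by case. Qed.

Fact adjoin_one_mul1 : right_id None adjoin_one_mul.
Proof. by case. Qed.

HB.instance Definition _ := Choice.on (adjoin_one B).
HB.instance Definition _ := isMonoid.Build (adjoin_one B)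
  adjoin_one_mulA adjoin_one_1mul adjoin_one_mul1.
End AdjoinOne.

Lemma finite_band (B : semigroupType) (A : set B) :
  (forall x : B, x * x = x) -> finite_set A ->
  finite_set (smallest (@subsemigroup B) A).
Proof.
move=> idemB finA.
have idemB1 (x : adjoin_one B) : x * x = x.
  by case: x => // x; congr Some; exact: idemB.
pose A1 : set (adjoin_one B) := Some @` A.
pose P := [set \prod_(x <- w) x | w in [set w | {in w, forall x, A1 x}]].
have finP : finite_set P by apply: finite_products => //; exact: finite_image.
have : finite_set (Some @^-1` P).
  by apply: finite_preimage finP => x y _ _ [].
apply: sub_finite_set; apply: smallest_sub.
  move=> x y [v Av vx] [w Aw wy]; exists (v ++ w).
    by move=> z; rewrite mem_cat => /orP[/Av|/Aw].
  by rewrite big_cat /= vx wy.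
move=> x Ax; exists [:: Some x]; last by rewrite big_seq1.
by move=> z; rewrite inE => /eqP ->; exists x.
Qed.


(** * Congruences that relate each element to its square *)
Section CongruenceQuotient.
Variables (S : semigroupType) (K : S -> S -> Prop).
Hypothesis congrK : congruence K.

Let relK : rel S := fun x y => `[< K x y >].

Fact relK_refl : reflexive relK.
Proof. by case: congrK => -[refK _ _] _ x; apply/asboolP; exact: refK. Qed.

Fact relK_sym : symmetric relK.
Proof.
case: congrK => -[_ _ symK] _ x y.
by apply/asboolP/asboolP; exact: symK.
Qed.

Fact relK_trans : transitive relK.
Proof.
case: congrK => -[_ trK _] _ y x z /asboolP xy /asboolP yz.
by apply/asboolP; exact: trK yz.
Qed.

Definition congruence_equiv := EquivRel relK relK_refl relK_sym relK_trans.

Definition quotient := {eq_quot congruence_equiv}%qT.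
HB.instance Definition _ := Choice.on quotient.

Definition class_of (x : S) : quotient :=
  (\pi_({eq_quot congruence_equiv}) x)%qT.

Lemma class_ofP x y : class_of x = class_of y <-> K x y.
Proof. by split=> [/eqmodP/asboolP|Kxy] //; apply/eqmodP/asboolP. Qed.

Lemma class_of_repr (c : quotient) : exists x, c = class_of x.
Proof. by exists (repr c); rewrite /class_of reprK. Qed.

Definition quotient_mul (c d : quotient) : quotient :=
  class_of (repr c * repr d).

Lemma quotient_mulE x y :
  quotient_mul (class_of x) (class_of y) = class_of (x * y).
Proof.
apply/class_ofP; case: congrK => _; apply; apply/class_ofP;
  by rewrite /class_of reprK.
Qed.

Fact quotient_mulA : associative quotient_mul.
Proof.
move=> c d e; have [x ->] := class_of_repr c; have [y ->] := class_of_repr d.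
by have [z ->] := class_of_repr e; rewrite !quotient_mulE mulgA.
Qed.

HB.instance Definition _ := isSemigroup.Build quotient quotient_mulA.

Lemma class_ofM x y : class_of (x * y) = class_of x * class_of y.
Proof. exact/esym/quotient_mulE. Qed.

End CongruenceQuotient.

(** In the band S / K the images of x and crinv x are commuting mutually inverse
    idempotents, and such elements coincide: both equal their product.  So the
    images of the generators generate S / K by multiplication alone. *)
Lemma finitely_many_classes_congruence (S : crSemigroupType)
    (K : S -> S -> Prop) :
  congruence K -> (forall x, K x (x * x)) -> finitely_generated S ->
  finitely_many_classes K.
Proof.
move=> congrK idemK [A [finA genA]].
pose cl := class_of congrK.
have cl_idem x : cl x * cl x = cl x.
  by rewrite -class_ofM; apply/esym/class_ofP.
have band_quot (c : quotient congrK) : c * c = c.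
  by have [x ->] := class_of_repr c; exact: cl_idem.
have cl_inv x : cl (crinv x) = cl x.
  have xx' := congr1 cl (mulg_crinv_mulg x).
  have x'x := congr1 cl (mulg_crinv_mulg (crinv x)).
  have comm := congr1 cl (crinv_comm x).
  move: xx' x'x comm; rewrite crinvK /cl !class_ofM -/cl => xx' x'x comm.
  by rewrite -x'x -comm -mulgA cl_idem comm -[RHS]xx'
    -mulgA -comm mulgA cl_idem comm.
have finB : finite_set (smallest (@subsemigroup _) (cl @` A)).
  by apply: finite_band => //; exact: finite_image.
have genB x : smallest (@subsemigroup _) (cl @` A) (cl x).
  suff : setT `<=` [set x | smallest (@subsemigroup _) (cl @` A) (cl x)].
    by apply.
  rewrite -genA; apply: smallest_sub; last first.
    by move=> a Aa B [_]; apply; exists a.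
  split=> [y z gy gz B BP|y gy] /=; last by rewrite cl_inv.
  rewrite /cl class_ofM; case: (BP) => subB _.
  by apply: subB; [exact: gy|exact: gz].
pose class_set (c : quotient congrK) : set S := [set b | c = cl b].
apply: (sub_finite_set _ (finite_image class_set finB)).
move=> _ [x _ <-]; exists (cl x) => //.
by apply/seteqP; split=> y /(class_ofP congrK).
Qed.

(** * Green's relations; D is a congruence on a completely regular semigroup *)
Section GreenRelations.
Variable S : semigroupType.
Implicit Types a b c : S.

Lemma greenLP a b : greenL a b <-> left_ideal b a /\ left_ideal a b.
Proof.
split=> [ab|[ba ab]]; first by split; [rewrite -ab|rewrite ab]; left.
have sub x y : left_ideal x y -> left_ideal y `<=` left_ideal x.
  move=> [->|[s _ <-]] // _ [->|[t _ <-]]; first by right; exists s.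
  by right; exists (t * s) => //; rewrite mulgA.
by apply/seteqP; split; exact: sub.
Qed.

Lemma greenRP a b : greenR a b <-> right_ideal b a /\ right_ideal a b.
Proof.
split=> [ab|[ba ab]]; first by split; [rewrite -ab|rewrite ab]; left.
have sub x y : right_ideal x y -> right_ideal y `<=` right_ideal x.
  move=> [->|[s _ <-]] // _ [->|[t _ <-]]; first by right; exists s.
  by right; exists (s * t) => //; rewrite mulgA.
by apply/seteqP; split; exact: sub.
Qed.

Lemma greenL_mulr a b c : greenL a b -> greenL (a * c) (b * c).
Proof.
have sub x y : left_ideal x y -> left_ideal (x * c) (y * c).
  by move=> [->|[s _ <-]]; [left|right; exists s => //; rewrite mulgA].
by move=> /greenLP[ba ab]; apply/greenLP; split; exact: sub.
Qed.

Lemma greenR_mull a b c : greenR a b -> greenR (c * a) (c * b).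
Proof.
have sub x y : right_ideal x y -> right_ideal (c * x) (c * y).
  by move=> [->|[s _ <-]]; [left|right; exists s => //; rewrite mulgA].
by move=> /greenRP[ba ab]; apply/greenRP; split; exact: sub.
Qed.

End GreenRelations.

Section CompletelyRegular.
Variable S : crSemigroupType.
Implicit Types a b c : S.

(** The element a is recovered from a * a by multiplying with crinv a on either
    side. *)
Lemma greenH_square a : greenH a (a * a).
Proof.
split.
  apply/greenLP; split; right; last by exists a.
  by exists (crinv a) => //; rewrite mulgA -crinv_comm mulg_crinv_mulg.
apply/greenRP; split; right; last by exists a.
by exists (crinv a) => //; rewrite -mulgA crinv_comm mulgA mulg_crinv_mulg.
Qed.

Lemma greenD_trans a b c : greenD a b -> greenD b c -> greenD a c.
Proof. exact: rst_trans. Qed.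

Lemma greenL_greenD a b : greenL a b -> greenD a b.
Proof. by move=> ab; apply: rst_step; left. Qed.

Lemma greenR_greenD a b : greenR a b -> greenD a b.
Proof. by move=> ab; apply: rst_step; right. Qed.

(** The middle element is a b a.  It is R-related to a b because
    a b = (a b)(a b)(a b)' = (a b a)(b (a b)'), and L-related to b a by the
    mirror image of that computation. *)
Lemma greenD_mulC a b : greenD (a * b) (b * a).
Proof.
apply: (@greenD_trans _ (a * b * a)).
  apply: greenR_greenD; apply/greenRP; split; right; last by exists a.
  exists (b * crinv (a * b)) => //.
  by rewrite -(mulgA (a * b)) (mulgA a b) crinv_comm mulgA mulg_crinv_mulg.
apply: greenL_greenD; apply/greenLP; split; right.
  by exists a => //; rewrite mulgA.
exists (crinv (b * a) * b) => //.
by rewrite -mulgA (mulgA b) (mulgA b) -(mulgA (b * a)) mulgA -crinv_comm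
  mulg_crinv_mulg.
Qed.

(** Right multiplication preserves L; left multiplication preserves R, and
    [greenD_mulC] exchanges the two sides. *)
Lemma greenD_mulr a b c : greenD a b -> greenD (a * c) (b * c).
Proof.
elim=> [x y [xy|xy]|x|x y _|x y z _ xy _ yz].
- exact/greenL_greenD/greenL_mulr.
- apply: greenD_trans (greenD_mulC _ _) _.
  apply: greenD_trans (greenD_mulC _ _).
  exact/greenR_greenD/greenR_mull.
- exact: rst_refl.
- exact: rst_sym.
- exact: greenD_trans xy yz.
Qed.

Lemma greenD_congruence : congruence (@greenD S).
Proof.
split=> [|a b c d ab cd].
  split; [exact: rst_refl|exact: rst_trans|exact: rst_sym].
apply: greenD_trans (greenD_mulr c ab) _.
apply: greenD_trans (greenD_mulC _ _) _.
apply: greenD_trans (greenD_mulC _ _).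
exact: greenD_mulr.
Qed.

End CompletelyRegular.

(** * The opposite semigroup and regular orthogroups *)

(** An alias, so that S and its opposite can carry different multiplications on
    the same carrier; greenL of the one is by conversion greenR of the other. *)
Definition dual (S : Type) := S.

HB.instance Definition _ (S : choiceType) := Choice.on (dual S).

Section DualSemigroup.
Variable S : semigroupType.

Definition dual_mul (x y : dual S) : dual S := (y : S) * (x : S).

Fact dual_mulA : associative dual_mul.
Proof. by move=> x y z; rewrite /dual_mul mulgA. Qed.

HB.instance Definition _ := isSemigroup.Build (dual S) dual_mulA.
End DualSemigroup.

Section DualCompletelyRegular.
Variable S : crSemigroupType.

Definition dual_crinv (x : dual S) : dual S := crinv (x : S).

Fact dual_crinvK : involutive dual_crinv.
Proof. exact: (@crinvK S). Qed.

Fact dual_mul_crinv_mul (x : dual S) : x * dual_crinv x * x = x.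
Proof. by rewrite /mul/= /dual_mul mulgA; exact: (@mulg_crinv_mulg S). Qed.

Fact dual_crinv_comm (x : dual S) : x * dual_crinv x = dual_crinv x * x.
Proof. exact/esym/(@crinv_comm S). Qed.

HB.instance Definition _ := isCompletelyRegular.Build (dual S)
  dual_crinvK dual_mul_crinv_mul dual_crinv_comm.
End DualCompletelyRegular.

Lemma finitely_generated_dual (S : crSemigroupType) :
  finitely_generated S -> finitely_generated (dual S).
Proof.
move=> [A [finA genA]]; exists A; split=> //.
apply/seteqP; split=> // x _ B [[mulB invB] AB].
have : smallest (@closed_subalgebra S) A x by rewrite genA.
by apply; split=> //; split=> // y z By Bz; exact: mulB.
Qed.

Lemma LRO_dual (S : crSemigroupType) : LRO S -> RRO (dual S).
Proof.
move=> [orthoS [bandS lrS]]; have subE : subsemigroup (@idempotents (dual S)).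
  by move=> x y Ex Ey; exact: orthoS.
split=> //; split=> [|a x Ea Ex]; first by split.
by rewrite -mulgA; exact: lrS.
Qed.

Lemma sub_LRO_RO : subclass LRO RO.
Proof.
move=> S [orthoS [bandS lrS]]; split=> //; split=> // a x y Ea Ex Ey.
by rewrite -(lrS a x).
Qed.

Lemma sub_RRO_RO : subclass RRO RO.
Proof.
move=> S [orthoS [bandS rrS]]; split=> //; split=> // a x y Ea Ex Ey.
by rewrite -[RHS]mulgA -[RHS]mulgA (mulgA a y a) -(rrS a y) // !mulgA.
Qed.

(** * A left regular orthogroup with infinitely many R-classes *)

(** The maps x |-> g + x and x |-> n of Z into itself, multiplied by
    composition. *)
Inductive affine := Translation of int | Constant of int.

Definition affine_code (f : affine) : int + int :=
  match f with Translation g => inl g | Constant n => inr n end.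

Definition affine_decode (c : int + int) : affine :=
  match c with inl g => Translation g | inr n => Constant n end.

Fact affine_codeK : cancel affine_code affine_decode.
Proof. by case. Qed.

HB.instance Definition _ := Choice.copy affine (can_type affine_codeK).

Definition affine_mul (f h : affine) : affine :=
  match f, h with
  | Translation g, Translation g' => Translation (g + g')%R
  | Translation g, Constant n => Constant (g + n)%R
  | Constant n, _ => Constant n
  end.

Fact affine_mulA : associative affine_mul.
Proof. by move=> [g|n] [g'|n'] [g''|n''] //=; rewrite GRing.addrA. Qed.

HB.instance Definition _ := isSemigroup.Build affine affine_mulA.

(** The translations form a group, and each constant is idempotent, hence its
    own inverse. *)
Definition affine_inv (f : affine) : affine :=
  match f with Translation g => Translation (- g)%R | Constant n => f end.

Fact affine_invK : involutive affine_inv.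
Proof. by case=> //= g; rewrite GRing.opprK. Qed.

Fact affine_mul_inv_mul (f : affine) : f * affine_inv f * f = f.
Proof.
by case: f => //= g; congr Translation; rewrite GRing.subrr GRing.add0r.
Qed.

Fact affine_inv_comm (f : affine) : f * affine_inv f = affine_inv f * f.
Proof. by case: f => //= g; congr Translation; rewrite GRing.addrC. Qed.

HB.instance Definition _ := isCompletelyRegular.Build affine
  affine_invK affine_mul_inv_mul affine_inv_comm.

Lemma affine_idempotents (f : affine) : idempotents f ->
  f = Translation 0 \/ exists n, f = Constant n.
Proof.
case: f => [g|n] Ef; [left|by right; exists n].
case: Ef => /(congr1 (fun x => x - g)%R).
by rewrite GRing.addrK GRing.subrr => ->.
Qed.

Lemma affine_LRO : LRO affine.
Proof.
have sub : subsemigroup (@idempotents affine).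
  by move=> x y /affine_idempotents[->|[n ->]] /affine_idempotents[->|[m ->]].
split=> //; split=> [|f h]; first by split=> // f.
by move=> /affine_idempotents[->|[n ->]] /affine_idempotents[->|[m ->]].
Qed.

Lemma affine_finitely_generated : finitely_generated affine.
Proof.
exists [set Translation 1; Constant 0]; split; first exact: finite_set2.
apply/seteqP; split=> // f _ B [[mulB invB] genB].
have trB (n : nat) : B (Translation n%:Z).
  elim: n => [|n IHn].
    exact: mulB (invB _ (genB _ (or_introl erefl))) (genB _ (or_introl erefl)).
  by rewrite intS; exact: mulB (genB _ (or_introl erefl)) IHn.
have trZB g : B (Translation g).
  by case: (intP g) => [|n|n]; [exact: trB| exact: trB|exact: (invB _ (trB _))].
case: f => [g|n]; first exact: trZB.
have := mulB _ _ (trZB n) (genB _ (or_intror erefl)).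
by rewrite /mul/= GRing.addr0.
Qed.

(** A constant absorbs every right factor, so its principal right ideal is a
    singleton. *)
Lemma affine_greenR_infinite : ~ finitely_many_classes (@greenR affine).
Proof.
have cls n : [set f | greenR (Constant n) f] = [set Constant n].
  apply/seteqP; split=> f /= => [/greenRP[_ [->|[h _ <-]]]|->] //.
pose cl (n : nat) := [set f | greenR (Constant n%:Z) f].
move=> /(sub_finite_set (A := range cl)) fin.
have {}fin : finite_set (range cl).
  by apply: fin => _ [n _ <-]; exists (Constant n%:Z).
apply: infinite_nat.
have: finite_set (cl @^-1` range cl); last first.
  by apply: sub_finite_set => n _; exists n.
apply: finite_preimage fin.
by move=> m n _ _; rewrite /cl !cls => /seteqP[/(_ _ erefl) [] []].
Qed.

Lemma not_locally_finite_greenR (V : cr_class) :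
  subclass LRO V -> ~ locally_finite greenR V.
Proof.
move=> subV finV; apply: affine_greenR_infinite.
by apply: finV; [exact/subV/affine_LRO|exact: affine_finitely_generated].
Qed.

(** The opposite of [affine] is the witness, because R-classes become
    L-classes. *)
Lemma not_locally_finite_greenL (V : cr_class) :
  subclass RRO V -> ~ locally_finite greenL V.
Proof.
move=> subV finV; apply: affine_greenR_infinite.
apply: (finV (dual affine)); first exact/subV/LRO_dual/affine_LRO.
exact/finitely_generated_dual/affine_finitely_generated.
Qed.

(** * Local finiteness of the varieties *)
Lemma locally_finite_of_congruence
    (K : forall S : semigroupType, S -> S -> Prop)
    (V : cr_class) :
  (forall S, V S -> congruence (K S)) ->
  (forall S : crSemigroupType, forall a : S, K S a (a * a)) ->
  locally_finite K V.
Proof.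
by move=> congrK sqK S VS; apply: finitely_many_classes_congruence; auto.
Qed.

Theorem theorem4p10 :
  (forall V : cr_class, variety V -> subclass V BG ->
     locally_finite greenH V)
  /\ (forall V : cr_class, variety V -> subclass LRO V -> subclass V ROLstar ->
        locally_finite greenL V /\ ~ locally_finite greenR V)
  /\ (forall V : cr_class, variety V -> subclass RRO V -> subclass V RORstar ->
        locally_finite greenR V /\ ~ locally_finite greenL V)
  /\ (forall V : cr_class, variety V -> subclass RO V -> subclass V CR ->
        locally_finite greenD V /\
        ~ locally_finite greenL V /\ ~ locally_finite greenR V).
Proof.
split; [|split; [|split]] => V _.
- move=> VBG; apply: locally_finite_of_congruence => [S /VBG //|S a].
  exact: greenH_square.
- move=> LROV Vsub; split; last exact: not_locally_finite_greenR.
  apply: locally_finite_of_congruence => [S /Vsub[] //|S a].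
  by case: (greenH_square a).
- move=> RROV Vsub; split; last exact: not_locally_finite_greenL.
  apply: locally_finite_of_congruence => [S /Vsub[] //|S a].
  by case: (greenH_square a).
- move=> ROV _; split; [|split].
  + apply: locally_finite_of_congruence => [S _|S a].
      exact: greenD_congruence.
    by apply: greenL_greenD; case: (greenH_square a).
  + by apply: not_locally_finite_greenL => S /sub_RRO_RO/ROV.
  + by apply: not_locally_finite_greenR => S /sub_LRO_RO/ROV.
Qed.
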